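(* Let $A$ be a topped PCM, let $S$ be an invertible separating relation on $A$, and let $R$ be the predicate on states over $A$ given by $R(s):\Leftrightarrow s_{\mathtt s}\,S\,s_{\mathtt o}$. Then $R$ is duplicable, i.e., for every state $s$, $R(s)\Leftrightarrow (R\ast R)(s)$.
   Context: A topped PCM is a tuple $(A,\bullet,\mathbb{1},\top,D)$ where $\bullet$ is a total commutative associative binary operation on $A$ with unit $\mathbb{1}$, $\top\in A$, and $D\subseteq A$ (the defined elements) satisfy: $\top\notin D$; $\mathbb{1}\in D$; if $x\bullet y\in D$ then $x,y\in D$; $x\bullet\top=\top\bullet x=\top$. Write $x\perp y$ for $x\bullet y\in D$. A relation $R$ on $A$ is a separating relation if: (1) $x\,R\,y$ implies $x\,R\,\mathbb{1}$; (2) $x\,R\,y$ implies $x\perp y$; (3) $\mathbb{1}\,R\,\mathbb{1}$; (4) $x\,R\,y$ iff $y\,R\,x$; (5) $x\,R\,y$ and $(x\bullet y)\,R\,z$ imply $x\,R\,(y\bullet z)$ and $y\,R\,z$. A separating relation $R$ is invertible if for all $a_1,a_2,a'$ with $a_1\,R\,(a_2\bullet a')$ and $a_2\,R\,(a_1\bullet a')$ one has $a_1\,R\,a_2$ and $(a_1\bullet a_2)\,R\,a'$. A state over $A$ is a pair $s=(s_{\mathtt s},s_{\mathtt o})\in A\times A$ with $s_{\mathtt s}\perp s_{\mathtt o}$. For states $s,s_1,s_2$, write $s=s_1\star s_2$ if there are $a_1,a_2,a'\in A$ with $s=(a_1\bullet a_2,a')$, $s_1=(a_1,a_2\bullet a')$,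 $s_2=(a_2,a_1\bullet a')$. For predicates $P,Q$ on states, $(P\ast Q)(s):\Leftrightarrow\exists s_1,s_2.\ s=s_1\star s_2\wedge P(s_1)\wedge Q(s_2)$. *)

(* Defs.v *)
From mathcomp Require Import all_boot.

Set Implicit Arguments.
Unset Strict Implicit.
Unset Printing Implicit Defensive.

(* [tpcm_def] is the subset D of defined elements; it is not assumed to be
   decidable, and the carrier is an arbitrary type. *)
Record toppedPCM : Type := ToppedPCM {
  tpcm_sort :> Type;
  tpcm_op : tpcm_sort -> tpcm_sort -> tpcm_sort;
  tpcm_unit : tpcm_sort;
  tpcm_top : tpcm_sort;
  tpcm_def : tpcm_sort -> Prop;
  tpcm_opC : commutative tpcm_op;
  tpcm_opA : associative tpcm_op;
  tpcm_op1x : left_id tpcm_unit tpcm_op;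
  tpcm_opx1 : right_id tpcm_unit tpcm_op;
  tpcm_topN : ~ tpcm_def tpcm_top;
  tpcm_def1 : tpcm_def tpcm_unit;
  tpcm_defM : forall x y, tpcm_def (tpcm_op x y) -> tpcm_def x /\ tpcm_def y;
  tpcm_opxT : right_zero tpcm_top tpcm_op;
  tpcm_opTx : left_zero tpcm_top tpcm_op
}.

Arguments tpcm_op {t} x y.
Arguments tpcm_unit {t}.
Arguments tpcm_top {t}.
Arguments tpcm_def {t} x.

Declare Scope tpcm_scope.
Delimit Scope tpcm_scope with tpcm.
Local Open Scope tpcm_scope.

Notation "x \bullet y" := (tpcm_op x y)
  (at level 40, left associativity) : tpcm_scope.
Notation "\one" := tpcm_unit (at level 0) : tpcm_scope.

Definition orth (A : toppedPCM) (x y : A) : Prop := tpcm_def (x \bullet y).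

Notation "x \perp y" := (orth x y) (at level 70, no associativity) : tpcm_scope.

Record separating (A : toppedPCM) (R : A -> A -> Prop) : Prop := Separating {
  sep_unit_r : forall x y, R x y -> R x \one;
  sep_orth : forall x y, R x y -> x \perp y;
  sep_unit : R \one \one;
  sep_sym : forall x y, R x y <-> R y x;
  sep_assoc : forall x y z,
    R x y -> R (x \bullet y) z -> R x (y \bullet z) /\ R y z
}.

Definition invertible (A : toppedPCM) (R : A -> A -> Prop) : Prop :=
  forall a1 a2 a' : A,
    R a1 (a2 \bullet a') -> R a2 (a1 \bullet a') ->
    R a1 a2 /\ R (a1 \bullet a2) a'.

Record state (A : toppedPCM) : Type := State {
  self : A;
  other : A;
  state_orth : self \perp other
}.

(* States are compared through their two components, so that the proofs of
   orthogonality play no role. *)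
Definition state_star (A : toppedPCM) (s s1 s2 : state A) : Prop :=
  exists a1 a2 a' : A,
    [/\ (self s, other s) = (a1 \bullet a2, a'),
        (self s1, other s1) = (a1, a2 \bullet a') &
        (self s2, other s2) = (a2, a1 \bullet a')].

Definition sepconj (A : toppedPCM) (P Q : state A -> Prop) : state A -> Prop :=
  fun s => exists s1 s2 : state A, [/\ state_star s s1 s2, P s1 & Q s2].

Definition duplicable (A : toppedPCM) (P : state A -> Prop) : Prop :=
  forall s : state A, P s <-> sepconj P P s.

Definition state_rel (A : toppedPCM) (S : A -> A -> Prop) : state A -> Prop :=
  fun s => S (self s) (other s).

(* Main.v *)
(* A state (a, a') splits as (a, a') together with (1, a \bullet a'): from
   [a S a'] one gets [1 S a], and reassociating [(1 \bullet a) S a'] gives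
   [1 S (a \bullet a')]. The converse is exactly invertibility. *)
Require Import Defs.
From mathcomp Require Import all_boot.

Theorem lemma4p12 (A : toppedPCM) (S : A -> A -> Prop)
    (sepS : separating S) (invS : invertible S) :
  duplicable (state_rel S).
Proof.
move=> s; split=> [Ss | [s1 [s2 [[a1 [a2 [a' [[es eo] [es1 eo1] [es2 eo2]]]]]]]]].
- have S1a : S tpcm_unit (self s) by apply/(sep_sym sepS)/(sep_unit_r sepS Ss).
  have [S1aa' _] : S tpcm_unit (tpcm_op (self s) (other s)) /\
                   S (self s) (other s).
    by apply: (sep_assoc sepS S1a); rewrite tpcm_op1x.
  (* The pair [(1, a \bullet a')] is a state because a separating relation implies orthogonality;
     [S1aa'] is also its membership in [state_rel S], so only the splitting itself remains. *)
  exists s, (State (sep_orth sepS S1aa')); split=> //.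
  exists (self s), tpcm_unit, (other s).
  by rewrite tpcm_opx1 tpcm_op1x.
(* The component equations turn the memberships of [s1] and [s2] into the two premises of
   invertibility, whose second conclusion is the claim about [s]. *)
- rewrite /state_rel es eo es1 eo1 es2 eo2 => S1 S2.
  by have [] := invS _ _ _ S1 S2.
Qed.
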